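(* Let $1\le t\le n$ and write $n=at+b$ with $a\ge1$ and $0\le b<t$. Then for all $s\ge1$, $$\mathrm{mult}\bigl(S/I_t(L_n)^s\bigr)=\binom{s+a-1}{s-1}\binom{a+t-b-1}{a}.$$ In particular, $\mathrm{mult}(S/I_t(L_n)^s)$ is a polynomial in $s$ of degree $a$ for all $s\ge1$.
   Context: $K$ is a field, $S=K[x_1,\ldots,x_n]$ standard graded, $I_t(L_n)=(u_1,\ldots,u_{n-t+1})$ with $u_i=x_ix_{i+1}\cdots x_{i+t-1}$ (the $t$-path ideal of the line graph $L_n$ with edges $\{x_j,x_{j+1}\}$). For a finitely generated graded $S$-module $M$ of Krull dimension $d$, its Hilbert series is $\sum_i\dim_K M_i z^i=Q(M,z)/(1-z)^d$ with $Q(M,z)$ a Laurent polynomial and $Q(M,1)\neq0$; the multiplicity is $\mathrm{mult}(M)=e_0(M)=Q(M,1)$. *)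

(* Defs.v *)
From mathcomp Require Import all_boot all_algebra.
From mathcomp Require Import mpoly.

Set Implicit Arguments.
Unset Strict Implicit.
Unset Printing Implicit Defensive.

Import GRing.Theory.
Local Open Scope ring_scope.

Section Defs.
Variables (K : fieldType) (n : nat).

(* Standard grading: p is homogeneous of degree d (0 is homogeneous of every degree). *)
Definition homog_deg (d : nat) (p : {mpoly K[n]}) : bool :=
  all (fun m : 'X_{1..n} => mdeg m == d) (msupp p).

Definition in_ideal (gs : seq {mpoly K[n]}) (p : {mpoly K[n]}) : Prop :=
  exists cs : seq {mpoly K[n]},
    size cs = size gs /\ p = \sum_(k < size gs) cs`_k * gs`_k.

Fixpoint pow_gens (gs : seq {mpoly K[n]}) (s : nat) : seq {mpoly K[n]} :=
  match s with
  | 0 => [:: 1]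
  | s'.+1 => [seq a * b | a <- gs, b <- pow_gens gs s']
  end.

(* u_i = x_i x_{i+1} ... x_{i+t-1}; variables are 0-indexed: x_{j+1} is 'X_j. *)
Definition path_mon (t i : nat) : {mpoly K[n]} :=
  \prod_(j < n | (i <= j < i + t)%N) 'X_j.

Definition path_gens (t : nat) : seq {mpoly K[n]} :=
  [seq path_mon t i | i <- iota 0 (n - t).+1].

(* dim_K (S/J)_d = h, for J the ideal generated by gs:  there are h
   homogeneous polynomials of degree d whose classes form a K-basis of
   the degree-d component S_d / J_d of S/J. *)
Definition hilb_fun_at (gs : seq {mpoly K[n]}) (d h : nat) : Prop :=
  exists bs : seq {mpoly K[n]},
    [/\ size bs = h,
        all (homog_deg d) bs,
        (forall c : 'I_h -> K,
            in_ideal gs (\sum_(k < h) c k *: bs`_k) -> forall k, c k = 0) &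
        (forall p, homog_deg d p ->
            exists c : 'I_h -> K, in_ideal gs (p - \sum_(k < h) c k *: bs`_k))].

(* e is the multiplicity of S/J: writing the Hilbert series as
   Q(z)/(1-z)^dim with Q(1) <> 0, e = Q(1).  The identity
   (1-z)^dim * sum_i H(i) z^i = Q(z) is written coefficientwise. *)
Definition is_mult (gs : seq {mpoly K[n]}) (e : int) : Prop :=
  exists (H : nat -> nat) (dim : nat) (Q : {poly int}),
    [/\ forall i, hilb_fun_at gs i (H i),
        forall i : nat,
          \sum_(j < dim.+1 | (j <= i)%N)
             ((-1) ^+ j * ('C(dim, j))%:R * (H (i - j)%N)%:R : int) = Q`_i,
        Q.[1] != 0 &
        e = Q.[1]].

End Defs.

(* Main.v *)
(* A monomial of S lies outside I^s iff no s windows (with repetition) can be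
   packed below its exponent m, a condition that only depends on the truncated
   exponent min(m, s).  Grouping the standard monomials by truncated exponent
   f : [n] -> {0..s}, with F = {j | f j = s}, gives the Hilbert series
   sum_f z^|f| / (1 - z)^|F| over the standard f.  The complement of F must hit
   every window, so it has at least a points, as there are a disjoint windows;
   hence S/I^s has dimension n - a and its multiplicity is the number of
   standard f whose F has a complement C of size exactly a.  For such a minimum
   hitting set C, f is standard iff sum_{j in C} f j < s, which leaves
   binom(s + a - 1, a) choices for f on C; and minimum hitting sets correspond to
   monotone sequences of length a in a set of t - b elements. *)

Require Import Defs.
From mathcomp Require Import all_boot all_algebra.
From mathcomp Require Import mpoly.
From mathcomp Require Import zify ring.

Set Implicit Arguments.
Unset Strict Implicit.
Unset Printing Implicit Defensive.

Import GRing.Theory.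

(** * Monomial ideals and their Hilbert functions *)

Lemma in_ideal_add (K : fieldType) n (gs : seq {mpoly K[n]}) p q :
  in_ideal gs p -> in_ideal gs q -> in_ideal gs (p + q)%R.
Proof.
move=> [cs [scs ->]] [ds [sds ->]].
exists (mkseq (fun k => (cs`_k + ds`_k)%R) (size gs)); rewrite size_mkseq.
split=> //; rewrite -big_split; apply: eq_bigr => k _ /=.
by rewrite nth_mkseq // mulrDl.
Qed.

Lemma in_ideal_mul_gen (K : fieldType) n (gs : seq {mpoly K[n]}) p g :
  g \in gs -> in_ideal gs (p * g)%R.
Proof.
move=> g_gs; have ltg : (index g gs < size gs)%N by rewrite index_mem.
exists (mkseq (fun k => if k == index g gs then p else 0%R) (size gs)).
rewrite size_mkseq; split=> //.
rewrite (bigD1 (Ordinal ltg)) //= nth_mkseq // eqxx nth_index // big1 ?addr0 //.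
move=> k; rewrite -val_eqE /= => /negPf nk.
by rewrite nth_mkseq // nk mul0r.
Qed.

(** The support of a combination of the generators lies in the union of the supports of its
    summands, all made of multiples of a generator. Conversely, each term of [p] is a multiple of
    some generator. *)
Lemma in_ideal_monomials (K : fieldType) n (ms : seq 'X_{1..n}) (p : {mpoly K[n]}) :
  in_ideal [seq 'X_[m] | m <- ms]%R p <->
  {in msupp p, forall m, has (fun g => g <= m)%MM ms}.
Proof.
split=> [[cs [_ ->]] m /msupp_sum_le /flatten_mapP[k _]|Hp].
  have ltk : k < size ms by rewrite -(size_map (fun m => 'X_[m] : {mpoly K[n]})%R).
  rewrite (nth_map 0%MM) // (perm_mem (msuppMX _ _)) => /mapP[m' _ ->].
  apply/hasP; exists (nth 0%MM ms k); first by rewrite mem_nth.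
  by rewrite lem_addr.
rewrite [p]mpolyE big_seq; apply: big_ind => [||m mp].
- exists (nseq (size ms) 0%R); rewrite size_nseq size_map; split=> //.
  by rewrite big1 // => k _; rewrite nth_nseq if_same mul0r.
- by move=> *; apply: in_ideal_add.
have /hasP[g g_ms le_gm] := Hp m mp.
rewrite -(submK le_gm) mpolyXD scalerAl; apply: in_ideal_mul_gen.
by apply: map_f.
Qed.

Lemma hilb_fun_at_monomials (K : fieldType) n (ms L : seq 'X_{1..n}) d :
  uniq L ->
  (forall m, (m \in L) = (mdeg m == d) && ~~ has (fun g => g <= m)%MM ms) ->
  @hilb_fun_at K n [seq 'X_[m] | m <- ms]%R d (size L).
Proof.
move=> uL memL; exists [seq 'X_[m] | m <- L]%R.
have coefL (c : 'I_(size L) -> K) m :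
    ((\sum_(k < size L) c k *: ([seq 'X_[m] | m <- L] : seq {mpoly K[n]})`_k)@_m
     = \sum_(k < size L) c k * (nth 0%MM L k == m)%:R)%R.
  rewrite raddf_sum; apply: eq_bigr => k _ /=.
  by rewrite mcoeffZ (nth_map 0%MM) // mcoeffX.
have coef_nth (c : 'I_(size L) -> K) (k : 'I_(size L)) :
    (\sum_(i < size L) c i * (nth 0%MM L i == nth 0%MM L k)%:R = c k)%R.
  rewrite (bigD1 k) //= eqxx mulr1 big1 ?addr0 // => i ik.
  by rewrite nth_uniq // val_eqE (negPf ik) mulr0.
split; first by rewrite size_map.
- apply/allP => p /mapP[m]; rewrite memL => /andP[dm _] ->.
  by rewrite /homog_deg msuppX /= dm.
(* Since [L] has no repetition, [c k] is the coefficient of the [k]-th standard monomial; were it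
   nonzero, that monomial would be divisible by a generator. *)
- move=> c /in_ideal_monomials Hc k; apply: contraTeq (mem_nth 0%MM (ltn_ord k)).
  move=> ck; rewrite memL negb_and negbK Hc ?orbT // mcoeff_msupp coefL coef_nth //.
(* Subtracting from [p] its terms in [L] leaves only monomials of degree [d] outside [L], hence in
   the ideal. *)
- move=> p /allP hp; exists (fun k => p@_(nth 0%MM L k))%R.
  apply/in_ideal_monomials => m; rewrite mcoeff_msupp mcoeffB coefL.
  have [mL|mL] := boolP (m \in L).
    have lt_m : index m L < size L by rewrite index_mem.
    have := coef_nth (fun k => p@_(nth 0%MM L k))%R (Ordinal lt_m).
    by rewrite /= nth_index // => ->; rewrite subrr eqxx.
  rewrite big1 ?subr0 => [|i _].
    rewrite -mcoeff_msupp => /hp /= dm.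
    by move: mL; rewrite memL dm /= negbK.
  by case: eqP => [e|]; [move: mL; rewrite -e mem_nth|rewrite mulr0].
Qed.

(** * Monomials with bounded exponents as a finite type *)

Definition ffmon n D (f : {ffun 'I_n -> 'I_D.+1}) : 'X_{1..n} :=
  [multinom (f j : nat) | j < n].

Definition truncm n s (m : 'X_{1..n}) : 'X_{1..n} := [multinom minn (m j) s | j < n].

(** The bound [D] only serves finiteness: for [d <= D] every monomial of degree [d] has exponents at
    most [D], so none is lost. *)
Definition mons n (good : pred 'X_{1..n}) D d : seq 'X_{1..n} :=
  [seq ffmon f | f <- enum [pred f : {ffun 'I_n -> 'I_D.+1} |
                             (mdeg (ffmon f) == d) && good (ffmon f)]].

Lemma ffmon_inj n D : injective (@ffmon n D).
Proof.
move=> f g /mnmP e; apply/ffunP => j; apply: val_inj.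
by have := e j; rewrite !mnmE.
Qed.

Lemma uniq_mons n (good : pred 'X_{1..n}) D d : uniq (mons good D d).
Proof. by rewrite map_inj_uniq ?enum_uniq //; apply: ffmon_inj. Qed.

Lemma mem_mons n (good : pred 'X_{1..n}) D d m :
  d <= D -> (m \in mons good D d) = (mdeg m == d) && good m.
Proof.
move=> le_dD; apply/mapP/idP => [[f + ->]|/andP[/eqP dm gm]].
  by rewrite mem_enum inE.
have lt_m j : m j < D.+1.
  by rewrite ltnS (leq_trans _ le_dD) // -dm mdegE (bigD1 j) //= leq_addr.
have em : m = ffmon [ffun j => Ordinal (lt_m j)].
  by apply/mnmP => j; rewrite mnmE ffunE.
by exists [ffun j => Ordinal (lt_m j)]; rewrite // mem_enum inE -em dm eqxx.
Qed.

Lemma size_mons n (good : pred 'X_{1..n}) D d :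
  d <= D -> size (mons good D d) = size (mons good d d).
Proof.
move=> le_dD; apply/perm_size/uniq_perm; rewrite ?uniq_mons // => m.
by rewrite !mem_mons.
Qed.

(** * Hilbert series as polynomials modulo a power of the variable *)

Definition eq_modXn N (p q : {poly int}) := exists r, p = (q + r * 'X^N)%R.

Lemma eq_modXn_mul N p q p' q' :
  eq_modXn N p q -> eq_modXn N p' q' -> eq_modXn N (p * p')%R (q * q')%R.
Proof.
move=> [r ->] [r' ->]; exists (r * q' + q * r' + r * r' * 'X^N)%R; ring.
Qed.

Lemma eq_modXn_add N p q p' q' :
  eq_modXn N p q -> eq_modXn N p' q' -> eq_modXn N (p + p')%R (q + q')%R.
Proof. by move=> [r ->] [r' ->]; exists (r + r')%R; ring. Qed.

Lemma eq_modXn_refl N p : eq_modXn N p p.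
Proof. by exists 0%R; rewrite mul0r addr0. Qed.

Lemma coef_eq_modXn N p q i : eq_modXn N p q -> i < N -> (p`_i = q`_i)%R.
Proof. by move=> [r ->] lt_iN; rewrite coefD coefMXn lt_iN addr0. Qed.

Lemma coef_1subXn d i : (((1 - 'X) ^+ d : {poly int})`_i = (-1) ^+ i * 'C(d, i)%:R)%R.
Proof.
rewrite exprBn coef_sum.
rewrite (eq_bigr (fun j : 'I_d.+1 => (i == j)%:R * ((-1) ^+ j * 'C(d, j)%:R)))%R; last first.
  move=> j _; rewrite expr1n mulr1 coefMn.
  have -> : ((-1) ^+ j = ((-1) ^+ j)%:P :> {poly int})%R by rewrite rmorphXn rmorphN1.
  by rewrite coefCM coefXn -mulr_natr; ring.
have [le_id|lt_di] := leqP i d.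
  rewrite (bigD1 (Ordinal (le_id : i < d.+1))) //= eqxx mul1r big1 ?addr0 // => j.
  by rewrite -val_eqE /= eq_sym => /negPf ->; rewrite mul0r.
rewrite bin_small // mulr0 big1 // => j _.
by have := ltn_ord j; case: eqP => [<-|_]; [lia|rewrite mul0r].
Qed.

Lemma coef_1subXn_mul d (G : {poly int}) i :
  (((1 - 'X) ^+ d * G)`_i =
   \sum_(j < d.+1 | (j <= i)%N) (-1) ^+ j * 'C(d, j)%:R * G`_(i - j))%R.
Proof.
rewrite coefM; set F := fun j => ((-1) ^+ j * 'C(d, j)%:R * G`_(i - j) : int)%R.
rewrite (eq_bigr (fun j : 'I_i.+1 => F j)) => [|j _]; last by rewrite coef_1subXn.
(* Both sums are compared over one range containing [j <= i] and [j <= d]; the binomial coefficient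
   vanishes for [j > d]. *)
transitivity (\sum_(j < (d + i).+1 | (j <= i)%N && (j <= d)%N) F j)%R.
  rewrite (big_ord_widen (d + i).+1 F) ?ltnS ?leq_addl // big_mkcondr /=.
  apply: eq_bigr => j _; case: leqP => // lt_dj.
  by rewrite /F bin_small // mulr0 mul0r.
by rewrite (big_ord_widen_cond (d + i).+1 (fun j => j <= i) F) ?ltnS ?leq_addr.
Qed.

Definition full_set n s (f : {ffun 'I_n -> 'I_s.+1}) : {set 'I_n} :=
  [set j | f j == s :> nat].

(** The sum of ['X^|f| / (1 - 'X)^|F|] over the common denominator [(1 - 'X)^d], with [F] the full
    set of [f]. It is meant for [d] at least every [|F|], so that the subtraction in the exponent
    does not truncate. *)
Definition hilb_num n (good : pred 'X_{1..n}) s d : {poly int} :=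
  (\sum_(f : {ffun 'I_n -> 'I_s.+1} | good (ffmon f))
     (1 - 'X) ^+ (d - #|full_set f|) * 'X^(mdeg (ffmon f)))%R.

Lemma coef_gen_mons n (good : pred 'X_{1..n}) D d :
  ((\sum_(f : {ffun 'I_n -> 'I_D.+1} | good (ffmon f)) 'X^(mdeg (ffmon f)) : {poly int})`_d
   = (size (mons good D d))%:R)%R.
Proof.
rewrite size_map -cardE -sum1_card natr_sum coef_sum.
rewrite (eq_bigl _ _ (fun=> andbC _ _)) big_mkcondr /=.
by apply: eq_bigr => f _; rewrite coefXn eq_sym; case: eqP.
Qed.

Lemma geom_tail s D : s <= D ->
  ((1 - 'X) * (\sum_(k < D.+1 | minn k s == s :> nat) 'X^k)
   = 'X^s - 'X^(D.+1) :> {poly int})%R.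
Proof.
move=> le_sD.
rewrite -(big_mkord (fun k => minn k s == s) (fun k => 'X^k)%R).
rewrite (big_cat_nat (n := s)) //=; last first.
  exact: leqW.
rewrite big_nat_cond big1 ?add0r => [|k]; last by lia.
have -> : (\sum_(s <= k < D.+1 | minn k s == s :> nat) 'X^k
         = \sum_(s <= k < D.+1) 'X^k :> {poly int})%R.
  rewrite big_nat_cond [RHS]big_nat_cond; apply: eq_bigl => k; lia.
rewrite mulrBl mul1r mulr_sumr.
rewrite [X in (_ - X)%R](eq_bigr (fun k => 'X^(k.+1))%R); last by move=> k _; rewrite -exprS.
rewrite -sumrB -[RHS]opprB -telescope_sumr ?leqW // -sumrN.
by apply: eq_bigr => k _; rewrite opprB.
Qed.

(** The generating function of a truncation fibre factors over the coordinates. A coordinate below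
    [s] has one preimage; a full one ranges over [s..D], and one factor [1 - 'X] telescopes this to
    ['X^s] up to ['X^(D.+1)]. *)
Lemma trunc_fiber_gen n s D (b : {ffun 'I_n -> 'I_s.+1}) : s <= D ->
  eq_modXn D.+1
    ((1 - 'X) ^+ #|full_set b| *
       \sum_(f : {ffun 'I_n -> 'I_D.+1} | truncm s (ffmon f) == ffmon b)
          'X^(mdeg (ffmon f)))%R
    'X^(mdeg (ffmon b))%R.
Proof.
move=> le_sD.
pose Qf j (k : 'I_D.+1) := minn k s == b j.
have -> : (\sum_(f : {ffun 'I_n -> 'I_D.+1} | truncm s (ffmon f) == ffmon b)
          'X^(mdeg (ffmon f)) = \prod_j \sum_(k < D.+1 | Qf j k) 'X^k :> {poly int})%R.
  rewrite bigA_distr_big_dep; apply: eq_big => [f|f _].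
    apply/eqP/familyP => [/mnmP e j|e].
      by have := e j; rewrite !mnmE unfold_in /Qf => ->.
    by apply/mnmP => j; have := e j; rewrite !mnmE unfold_in => /eqP.
  by rewrite mdegE expr_sum; apply: eq_bigr => j _; rewrite mnmE.
have -> : ((1 - 'X) ^+ #|full_set b|
         = \prod_j (if j \in full_set b then 1 - 'X else 1) :> {poly int})%R.
  by rewrite -big_mkcond /= prodr_const.
rewrite -big_split mdegE expr_sum /=.
apply: big_ind2 => [||j _]; first exact: eq_modXn_refl.
  by move=> *; apply: eq_modXn_mul.
rewrite mnmE inE /Qf; case: eqP => [->|/eqP nb].
  by rewrite geom_tail //; exists (-1)%R; ring.
have lt_bs : b j < s by have := ltn_ord (b j); lia.
have lt_bD : b j < D.+1 by lia.
rewrite mul1r (bigD1 (Ordinal lt_bD)) /=; last by lia.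
rewrite big1 ?addr0 => [|k]; first exact: eq_modXn_refl.
by rewrite -val_eqE /=; lia.
Qed.

Lemma hilb_numE n (good : pred 'X_{1..n}) s d :
  (forall m, good (truncm s m) = good m) ->
  (forall b : {ffun 'I_n -> 'I_s.+1}, good (ffmon b) -> #|full_set b| <= d) ->
  forall i,
    (\sum_(j < d.+1 | (j <= i)%N)
       (-1) ^+ j * 'C(d, j)%:R * (size (mons good (i - j)%N (i - j)%N))%:R
     = (hilb_num good s d)`_i)%R.
Proof.
move=> good_trunc full_le i.
(* [D >= i] keeps coefficient [i] intact modulo ['X^(D.+1)] and [D >= s] is what the geometric tails
   require. *)
pose D := i + s.
transitivity (((1 - 'X) ^+ d * (\sum_(f : {ffun 'I_n -> 'I_D.+1} | good (ffmon f))
   'X^(mdeg (ffmon f))) : {poly int})`_i)%R.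
  rewrite coef_1subXn_mul; apply: eq_bigr => j _.
  by rewrite coef_gen_mons size_mons // /D; lia.
apply: (@coef_eq_modXn D.+1); last by rewrite /D; lia.
pose tr (f : {ffun 'I_n -> 'I_D.+1}) : {ffun 'I_n -> 'I_s.+1} :=
  [ffun j => inord (minn (f j) s)].
have trE f : ffmon (tr f) = truncm s (ffmon f).
  by apply/mnmP => j; rewrite !mnmE ffunE inordK // ltnS geq_minr.
rewrite (partition_big tr (fun b => good (ffmon b))) /=; last first.
  by move=> f; rewrite trE good_trunc.
rewrite mulr_sumr /hilb_num; apply: big_ind2 => [||b good_b].
- exact: eq_modXn_refl.
- by move=> *; apply: eq_modXn_add.
(* Of the [d] factors [1 - 'X], those indexed by the full set are spent on the fibre and the rest
   stay in the numerator. *)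
rewrite -{1}(subnK (full_le b good_b)) exprD -mulrA.
apply: eq_modXn_mul; first exact: eq_modXn_refl.
rewrite (eq_bigl (fun f => truncm s (ffmon f) == ffmon b)).
  by apply: trunc_fiber_gen; rewrite /D leq_addl.
move=> f; rewrite -trE (inj_eq (@ffmon_inj _ _)).
by case: eqP => [e|]; rewrite ?andbF // andbT -good_trunc -trE e.
Qed.

(** At 1, a positive power of [1 - 'X] vanishes, so only the cells whose full set has the maximal
    size [d] contribute, each by 1. *)
Lemma hilb_num1 n (good : pred 'X_{1..n}) s d :
  (forall b : {ffun 'I_n -> 'I_s.+1}, good (ffmon b) -> #|full_set b| <= d) ->
  ((hilb_num good s d).[1]
   = #|[set b : {ffun 'I_n -> 'I_s.+1} | good (ffmon b) && (#|full_set b| == d)]|%:R)%R.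
Proof.
move=> full_le; rewrite horner_sum -sum1_card natr_sum [RHS](eq_bigl
  (fun b => good (ffmon b) && (#|full_set b| == d))); last by move=> b; rewrite inE.
rewrite [RHS]big_mkcondr /=; apply: eq_bigr => b good_b.
rewrite (@hornerM int) !hornerXn expr1n mulr1 horner_exp.
rewrite hornerD hornerN hornerX hornerC subrr expr0n.
by rewrite subn_eq0 (eqn_leq _ d) (full_le b good_b) /=; case: (d <= _).
Qed.

(** * Powers of the path ideal through their exponent vectors *)

Definition win n t i : 'X_{1..n} := [multinom (i <= j < i + t : nat) | j < n].

Definition wins n t : seq 'X_{1..n} := [seq win n t i | i <- iota 0 (n - t).+1].

Fixpoint pow_exps n (ms : seq 'X_{1..n}) (s : nat) : seq 'X_{1..n} :=
  match s with
  | 0 => [:: 0%MM]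
  | s'.+1 => [seq (x + y)%MM | x <- ms, y <- pow_exps ms s']
  end.

Lemma path_gensE (K : fieldType) n t :
  path_gens K n t = [seq 'X_[m] | m <- wins n t]%R.
Proof.
rewrite /path_gens /wins -map_comp; apply: eq_map => i /=.
rewrite /path_mon mprodXE; congr 'X_[_]%R; apply/mnmP => j.
rewrite mnm_sumE mnmE big_mkcond (bigD1 j) //= mnm1E eqxx big1 ?addn0; last first.
  by move=> k /negPf kj; rewrite mnm1E kj if_same.
by case: ifP.
Qed.

Lemma pow_gensE (K : fieldType) n (ms : seq 'X_{1..n}) s :
  pow_gens [seq 'X_[m] | m <- ms] s = [seq 'X_[m] | m <- pow_exps ms s] :> seq {mpoly K[n]}.
Proof.
elim: s => [|s IH] /=; first by rewrite mpolyX0.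
rewrite IH map_allpairs allpairs_mapl allpairs_mapr.
by apply: eq_allpairs => // x y; rewrite mpolyXD.
Qed.

Lemma mem_winsP n t m : reflect (exists2 i, i <= n - t & m = win n t i) (m \in wins n t).
Proof.
apply: (iffP mapP) => [[i]|[i le_i ->]]; first by rewrite mem_iota add0n ltnS; exists i.
by exists i; rewrite // mem_iota add0n ltnS.
Qed.

Lemma mem_pow_wins n t s g : g \in pow_exps (wins n t) s.+1 ->
  exists i y, [/\ i <= n - t, y \in pow_exps (wins n t) s & g = (win n t i + y)%MM].
Proof. by case/allpairsPdep => x [y [/mem_winsP[i le_i ->] y_s ->]]; exists i, y. Qed.

Lemma pow_exps_le n t s g j : g \in pow_exps (wins n t) s -> g j <= s.
Proof.
elim: s g => [|s IH] g; first by rewrite inE => /eqP ->; rewrite mnmE.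
case/mem_pow_wins => i [y [_ /IH le_y ->]].
by rewrite mnmDE mnmE; case: (_ && _); lia.
Qed.

Definition std_mon n t s : pred 'X_{1..n} :=
  fun m => ~~ has (fun g => g <= m)%MM (pow_exps (wins n t) s).

(** A product of [s] squarefree windows has exponents at most [s], so divisibility by it does not
    see exponents beyond [s]. *)
Lemma std_mon_trunc n t s m : std_mon t s (truncm s m) = @std_mon n t s m.
Proof.
congr negb; apply: eq_in_has => g g_s; apply/mnm_lepP/mnm_lepP => le_g j.
  by have := le_g j; rewrite mnmE leq_min => /andP[].
by rewrite mnmE leq_min le_g (pow_exps_le _ g_s).
Qed.

(** * Hitting sets of the windows *)

Definition hitting n t (C : {set 'I_n}) : bool :=
  all (fun i => [exists c in C, i <= c < i + t]) (iota 0 (n - t).+1).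

Lemma hittingP n t (C : {set 'I_n}) :
  reflect (forall i, i <= n - t -> exists2 c, c \in C & i <= c < i + t) (hitting t C).
Proof.
apply: (iffP allP) => hC i; last first.
  by rewrite mem_iota add0n ltnS => /hC[c cC ic]; apply/exists_inP; exists c.
by move=> le_i; apply/exists_inP/hC; rewrite mem_iota add0n ltnS.
Qed.

Lemma pow_exps_win n t s i : i <= n - t -> (win n t i *+ s)%MM \in pow_exps (wins n t) s.
Proof.
move=> le_i; elim: s => [|s IH]; first by rewrite mulm0n inE.
by rewrite mulmS; apply: allpairs_f => //; apply/mem_winsP; exists i.
Qed.

(** A window that misses the complement lies inside the full set, and then its [s]-th power divides
    the monomial. *)
Lemma std_mon_hitting n t s (b : {ffun 'I_n -> 'I_s.+1}) :
  std_mon t s (ffmon b) -> hitting t (~: full_set b).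
Proof.
move=> /hasPn std_b; apply/allP => i; rewrite mem_iota add0n ltnS /= => le_i.
apply: contraR (std_b _ (pow_exps_win s le_i)) => /exists_inPn no_c.
apply/mnm_lepP => j; rewrite mulmnE !mnmE.
have [ij|_] := boolP (_ && _); rewrite ?mul0n // mul1n.
have [|nj] := boolP (j \in full_set b); first by rewrite inE => /eqP ->.
by have := no_c j; rewrite inE nj ij => /(_ isT).
Qed.

(** The windows starting at the multiples [k * t], [k < a], are pairwise disjoint; choosing a point
    of [C] in each one bounds the size of [C] from below. *)
Lemma hitting_blocks n t a (C : {set 'I_n}) : 0 < t -> a * t <= n -> hitting t C ->
  exists c : 'I_a -> 'I_n,
    forall k : 'I_a, (c k \in C) && (k * t <= c k < k * t + t).
Proof.
move=> t_gt0 le_n /hittingP hC; apply: (@fin_all_exists _ (fun=> 'I_n)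
  (fun (k : 'I_a) c => (c \in C) && (k * t <= c < k * t + t))) => k.
have [|c cC kc] := hC (k * t); last by exists c; rewrite cC.
by have : k.+1 * t <= a * t; [rewrite leq_mul2r ltn_ord orbT | lia].
Qed.

Lemma blocks_inj n t a (c : 'I_a -> 'I_n) :
  (forall k : 'I_a, k * t <= c k < k * t + t) -> injective c.
Proof.
move=> hc k k' e; apply: val_inj.
have hk := hc k; have := hc k'; rewrite -e => hk'.
by case: (ltngtP k k') => // lt_k; have := leq_mul lt_k (leqnn t); lia.
Qed.

Lemma hitting_card n t a (C : {set 'I_n}) :
  0 < t -> a * t <= n -> hitting t C -> a <= #|C|.
Proof.
move=> t_gt0 le_n /(hitting_blocks t_gt0 le_n)[c hc].
have c_inj : injective c by apply: (@blocks_inj n t) => k; case/andP: (hc k).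
rewrite -[a]card_ord -cardsT -(card_imset _ c_inj); apply/subset_leq_card/subsetP.
by move=> _ /imsetP[k _ ->]; case/andP: (hc k).
Qed.

Lemma hitting_sum n t s (C : {set 'I_n}) g :
  hitting t C -> g \in pow_exps (wins n t) s -> s <= \sum_(j in C) g j.
Proof.
move=> /hittingP hC; elim: s g => // s IH g /mem_pow_wins[i [y [le_i /IH le_y ->]]].
rewrite (eq_bigr (fun j => win n t i j + y j)) => [|j _]; last exact: mnmDE.
rewrite big_split /= -[s.+1]add1n leq_add //.
have [c cC ic] := hC i le_i.
by rewrite (bigD1 c) //= mnmE ic.
Qed.

(** Without [c] the set has fewer than [a] points, so it misses some window; [C] meets that window
    in [c] alone. *)
Lemma hitting_private n t a (C : {set 'I_n}) c :
  0 < t -> a * t <= n -> hitting t C -> #|C| = a -> c \in C ->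
  exists2 i, i <= n - t & {in C, forall c' : 'I_n, (i <= c' < i + t) = (c' == c)}.
Proof.
move=> t_gt0 le_n hC cardC cC.
have nhit : ~~ hitting t (C :\ c).
  by apply/negP => /(hitting_card t_gt0 le_n); rewrite -cardC (cardsD1 c C) cC ltnn.
have [i] := allPn nhit; rewrite mem_iota add0n ltnS /= => le_i nhit_i.
have only_c c' : c' \in C -> i <= c' < i + t -> c' = c.
  move=> c'C ic'; apply: contraNeq nhit_i => c'c.
  by apply/exists_inP; exists c' => //; rewrite !inE c'c.
exists i => // c' c'C; apply/idP/eqP => [|->]; first exact: only_c.
by have [c0 c0C ic0] := hittingP _ _ hC i le_i; rewrite -(only_c c0 c0C ic0).
Qed.

(* Each point of a minimum hitting set is alone in some window, so that windows
   can be packed along C independently of each other. *)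
Lemma private_packing n t a s (C : {set 'I_n}) (m : 'X_{1..n}) :
  0 < t -> a * t <= n -> hitting t C -> #|C| = a ->
  s <= \sum_(j in C) m j ->
  exists2 g, g \in pow_exps (wins n t) s & {in C, forall c, g c <= m c}.
Proof.
move=> t_gt0 le_n hC cardC.
(* Asking for weight exactly [k] on [C] makes the induction run: as long as [k] is below the weight
   of [m], some point of [C] has slack, and its private window uses up one unit there and nothing
   elsewhere on [C]. *)
suff packing k : k <= \sum_(j in C) m j -> exists g,
    [/\ g \in pow_exps (wins n t) k, {in C, forall c, g c <= m c}
      & \sum_(j in C) g j = k].
  by move=> /packing[g [g_s le_g _]]; exists g.
elim: k => [_|k IH lt_k].
  exists 0%MM; split=> [|c _|]; rewrite ?mnmE ?inE //.
  by rewrite big1 // => j _; rewrite mnmE.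
have [g [g_k le_g sum_g]] := IH (ltnW lt_k).
have [c cC lt_c] : exists2 c, c \in C & g c < m c.
  apply/exists_inP; apply: contraLR lt_k => /exists_inPn le_m.
  by rewrite -leqNgt -sum_g leq_sum // => j /le_m; rewrite -leqNgt.
have [i le_i ic] := hitting_private t_gt0 le_n hC cardC cC.
have gE j : j \in C -> (win n t i + g)%MM j = (j == c) + g j.
  by move=> jC; rewrite mnmDE mnmE ic.
exists (win n t i + g)%MM; split.
- by apply: allpairs_f => //; apply/mem_winsP; exists i.
- by move=> j jC; rewrite gE //; case: eqP => [->|_] //; apply: le_g.
rewrite (eq_bigr (fun j => (j == c) + g j)) // big_split /= sum_g.
by rewrite (bigD1 c) //= eqxx big1 // => j /andP[_ /negPf ->].
Qed.

(** Off [C] the exponent is [s], which no generator exceeds, so divisibility is decided on [C].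
    There every generator has weight at least [s], and weight [s] suffices by packing private
    windows. *)
Lemma std_mon_minimum n t a s (b : {ffun 'I_n -> 'I_s.+1}) (C : {set 'I_n}) :
  0 < t -> a * t <= n -> hitting t C -> #|C| = a -> full_set b = ~: C ->
  std_mon t s (ffmon b) = (\sum_(j in C) b j < s).
Proof.
move=> t_gt0 le_n hC cardC full_b.
have sumE : \sum_(j in C) ffmon b j = \sum_(j in C) b j.
  by apply: eq_bigr => j _; rewrite mnmE.
rewrite ltnNge; congr negb; apply/hasP/idP => [[g g_s /mnm_lepP le_g]|].
  by rewrite -sumE (leq_trans (hitting_sum hC g_s)) // leq_sum.
rewrite -sumE => /(private_packing t_gt0 le_n hC cardC)[g g_s le_g].
exists g => //; apply/mnm_lepP => j.
have [jC|jC] := boolP (j \in C); first exact: le_g.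
have : j \in full_set b by rewrite full_b inE.
by rewrite inE mnmE => /eqP ->; apply: pow_exps_le g_s.
Qed.

(** * Counting the top-dimensional cells *)

Lemma card_capped_functions n s (C : {set 'I_n}) c0 : c0 \in C ->
  #|[set b : {ffun 'I_n -> 'I_s.+2} |
      (full_set b == ~: C) && (\sum_(j in C) b j < s.+1)]| = 'C(#|C| + s, #|C|).
Proof.
move=> c0C; rewrite -card_partial_ord_partitions.
set B := [set b | _].
(* Values off [C] are forced to be [s.+1], so [b] amounts to its restriction to [C]: a tuple of
   length [#|C|] with sum at most [s]. *)
pose phi (b : {ffun 'I_n -> 'I_s.+2}) : #|C|.-tuple 'I_s.+1 :=
  [tuple inord (b (enum_val i)) | i < #|C|].
have b_small b j : b \in B -> j \in C -> b j < s.+1.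
  rewrite inE => /andP[_ sum_b] jC; apply: leq_ltn_trans sum_b.
  by rewrite (bigD1 j) //= leq_addr.
have phiE b i : b \in B -> tnth (phi b) i = b (enum_val i) :> nat.
  by move=> bB; rewrite tnth_mktuple inordK // b_small // enum_valP.
have phi_inj : {in B &, injective phi}.
  move=> b b' bB b'B e; apply/ffunP => j; apply: val_inj => /=.
  have [jC|jC] := boolP (j \in C).
    have := phiE b (enum_rank_in c0C j) bB.
    by rewrite e phiE // enum_rankK_in // => ->.
  have fullE b1 : b1 \in B -> b1 j = s.+1 :> nat.
    rewrite inE => /andP[/eqP/setP/(_ j)].
    by rewrite !inE jC => /eqP.
  by rewrite !fullE.
rewrite -(card_in_imset phi_inj); apply: eq_card => u; rewrite !inE.
apply/imsetP/idP => [[b bB ->]|sum_u].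
  rewrite big_tuple (eq_bigr (fun i => b (enum_val i) : nat)) => [|i _]; last exact: phiE.
  by move: bB; rewrite inE -(big_enum_val (fun j => b j : nat)) => /andP[_].
pose b : {ffun 'I_n -> 'I_s.+2} :=
  [ffun j => if j \in C then inord (tnth u (enum_rank_in c0C j)) else ord_max].
have bE i : b (enum_val i) = tnth u i :> nat.
  by rewrite ffunE enum_valP enum_valK_in inordK ?(leqW (ltn_ord _)).
have bB : b \in B.
  rewrite inE; apply/andP; split.
    apply/eqP/setP => j; rewrite !inE ffunE; case: (boolP (j \in C)) => _ /=.
      by rewrite inordK ?(leqW (ltn_ord _)) // ltn_eqF.
    by rewrite eqxx.
  rewrite (big_enum_val (fun j => b j : nat)) ltnS; apply: leq_trans sum_u.
  by rewrite big_tuple leq_sum // => i _; rewrite bE.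
by exists b => //; apply: eq_from_tnth => i; apply: val_inj; rewrite /= phiE // bE.
Qed.

(* A minimum hitting set has one point k t + (t - 1 - r_k) in each block
   [k t, (k + 1) t), k < a, and no other point; it hits all the windows iff
   r is nondecreasing with values in [0, t - b). *)
Lemma card_minimum_hitting n t a b : 0 < a -> b < t -> n = a * t + b ->
  #|[set C : {set 'I_n} | hitting t C && (#|C| == a)]| = 'C(a + t - b - 1, a).
Proof.
move=> a_gt0 lt_bt nE; have t_gt0 : 0 < t by lia.
(* [u.+1] is [t - b], the number of values allowed for the entries of [r]. *)
have [u tE] : exists u, t = b + u.+1 by exists (t - b.+1); lia.
have -> : a + t - b - 1 = a + u by lia.
have block k k' : k < k' -> k * t + t <= k' * t.
  by move=> lt_k; have := leq_mul lt_k (leqnn t); lia.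
have le_at : a * t <= n by lia.
rewrite -card_sorted_tuples.
pose pt (r : a.-tuple 'I_u.+1) (k : 'I_a) := k * t + (t.-1 - tnth r k).
have lt_r (r : a.-tuple 'I_u.+1) (k : 'I_a) : tnth r k < u.+1 by [].
have lt_pt r k : pt r k < n.
  by have := block _ _ (ltn_ord k); rewrite /pt; lia.
pose psi r : {set 'I_n} := [set Ordinal (lt_pt r k) | k : 'I_a].
have sortedP (r : a.-tuple 'I_u.+1) : reflect
    (forall k k' : 'I_a, k <= k' -> tnth r k <= tnth r k') (sorted leq (map val r)).
  have nthE (k : 'I_a) : nth 0 (map val r) k = tnth r k.
    by rewrite (nth_map ord0) ?size_tuple // (tnth_nth ord0).
  apply: (iffP idP) => [r_sorted k k' le_k|r_mono].
    rewrite -!nthE (sorted_leq_nth leq_trans leqnn) // inE size_map size_tuple //.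
  apply/(sortedP 0) => i; rewrite size_map size_tuple => lt_i.
  by have := r_mono (Ordinal (ltnW lt_i)) (Ordinal lt_i) (leqnSn i); rewrite -!nthE.
(* The offset [t.-1 - tnth r k] is below [t], so a point determines its block, then its offset. *)
have pt_inj r k r' k' : pt r k = pt r' k' -> k = k' /\ tnth r k = tnth r' k'.
  move=> e; have ek : k = k'.
    apply: val_inj; have := lt_r r k; have := lt_r r' k'; move: e; rewrite /pt /=.
    by case: (ltngtP k k') => // /block; lia.
  split=> //; apply: val_inj; subst k'.
  by have := lt_r r k; have := lt_r r' k; move: e; rewrite /pt /=; lia.
have mem_psi r k : Ordinal (lt_pt r k) \in psi r by apply: imset_f.
have psi_inj : injective psi.
  move=> r r' e; apply: eq_from_tnth => k.
  have := mem_psi r k; rewrite e => /imsetP[k' _ /(congr1 val) /= /pt_inj[<-]].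
  by [].
rewrite -(card_imset _ psi_inj); apply: eq_card => C; rewrite inE.
apply/andP/imsetP => [[hC /eqP cardC]|[r + ->]].
  have [c hc] := hitting_blocks t_gt0 le_at hC.
  have c_in k : c k \in C by case/andP: (hc k).
  have c_block (k : 'I_a) : k * t <= c k < k * t + t by case/andP: (hc k).
  have CE : C = [set c k | k : 'I_a].
    apply/eqP; rewrite eq_sym eqEcard; apply/andP; split.
      by apply/subsetP => _ /imsetP[k _ ->].
    by rewrite cardC card_imset ?cardsT ?card_ord //; apply: (blocks_inj c_block).
  (* For the last block [k = a - 1], the window starting at [b + k * t = n - t] is the last of all,
     and only the point of that block can hit it. *)
  have c_last (k : 'I_a) : k.+1 = a -> b + k * t <= c k.
    move=> ka; have [|c' + ic'] := hittingP _ _ hC (b + k * t).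
      by have := congr1 (muln^~ t) ka; rewrite /= mulSn; lia.
    rewrite CE => /imsetP[k' _ c'E]; have := c_block k'; rewrite -c'E => hk'.
    have ek : k' = k.
      apply: val_inj; have := ltn_ord k'; case: (ltngtP k' k) => // [/block|]; lia.
    by move: ic'; rewrite c'E ek => /andP[].
  (* The window starting right after [c k] lies beyond the earlier points and ends before block
     [k + 2], so the point of the next block must hit it. *)
  have c_step (k k' : 'I_a) : k.+1 = k' -> c k' <= c k + t.
    move=> ek; have [|c' + ic'] := hittingP _ _ hC (c k).+1.
      have := c_block k; have := block _ _ (ltn_ord k'); rewrite -ek mulSn; lia.
    rewrite CE => /imsetP[k1 _ c'E]; have := c_block k1; rewrite -c'E => hk1.
    have hk := c_block k.
    have le_k : k < k1.
      have [//|lt_k|e] := ltngtP k k1; first by have := block _ _ lt_k; lia.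
      by move: ic'; rewrite c'E -(val_inj e : k = k1) ltnn.
    have [lt_k|lt_k|e] := ltngtP k.+1 k1; last 1 first.
    - by have <- : k1 = k'; [apply: val_inj => /=; rewrite -ek | rewrite -c'E; lia].
    - by have := block _ _ lt_k; rewrite mulSn; lia.
    - by move: lt_k; rewrite ltnS leqNgt le_k.
  pose q (k : 'I_a) := c k - k * t.
  have q_anti (k k' : 'I_a) : k <= k' -> q k' <= q k.
    move=> le_k; move: (subnKC le_k); move: (k' - k) => m.
    elim: m k' {le_k} => [|m IH] k' ek.
      by have -> : k' = k by apply: val_inj => /=; lia.
    have lt_m : k + m < a by have := ltn_ord k'; lia.
    apply: leq_trans (IH (Ordinal lt_m) (erefl _)).
    have ek' : (Ordinal lt_m).+1 = k' by rewrite -ek addnS.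
    have := c_step _ _ ek'; have := c_block k'; have := c_block (Ordinal lt_m).
    by rewrite /q -ek' mulSn; lia.
  (* The offsets [q] decrease weakly along the blocks and the last one is at least [b], so all lie
     in [[b, t)]; reversing them gives a nondecreasing [r] with values in [[0, t - b)]. *)
  have q_ge k : b <= q k.
    have lt_a : a.-1 < a by lia.
    apply: leq_trans (q_anti k (Ordinal lt_a) _); last by have := ltn_ord k => /=; lia.
    by have := c_last (Ordinal lt_a) (prednK a_gt0); rewrite /q; lia.
  pose r := [tuple inord (t.-1 - q k) | k < a] : a.-tuple 'I_u.+1.
  have rE k : tnth r k = t.-1 - q k :> nat.
    by rewrite tnth_mktuple inordK //; have := q_ge k; lia.
  exists r.
    by rewrite inE; apply/sortedP => k k' /q_anti le_q; rewrite !rE; lia.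
  rewrite CE; apply: eq_imset => k; apply: val_inj; rewrite /= /pt rE /q.
  by have := c_block k; lia.
rewrite inE => /sortedP r_mono; split; last first.
  rewrite card_imset ?cardsT ?card_ord // => k k' /(congr1 val) /= /pt_inj[].
  by [].
apply/hittingP => i le_i.
have lt_ia : i %/ t < a by rewrite ltn_divLR //; lia.
have iE := divn_eq i t; have lt_mod := ltn_pmod i t_gt0.
pose k := Ordinal lt_ia; have kE : k = i %/ t :> nat by [].
(* The window at [i] starts in block [i %/ t]: it is hit there unless it starts after the point of
   that block, in which case the next point hits it because the offsets do not increase. *)
have [le_k|gt_k] := leqP (i %% t) (t.-1 - tnth r k).
  exists (Ordinal (lt_pt r k)) => //=.
  rewrite /pt kE; move: iE lt_mod le_k.
  by move: (i %/ t * t) (i %% t) (tnth r k : nat) => x y z; lia.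
(* In the last block, [i <= n - t] gives [i %% t <= b], whereas the offset is at least
   [t.-1 - u = b]; so a next block exists. *)
have lt_k : (i %/ t).+1 < a.
  rewrite ltnNge; apply/negP => ge_a.
  have ea : (i %/ t).+1 = a by lia.
  have := congr1 (muln^~ t) ea; rewrite /= mulSn.
  have := lt_r r k; move: le_i iE lt_mod gt_k.
  by move: (i %/ t * t) (i %% t) (tnth r k : nat) => x y z; lia.
exists (Ordinal (lt_pt r (Ordinal lt_k))) => //=.
have := r_mono k (Ordinal lt_k) (leqnSn _).
rewrite /pt /= mulSn; have := lt_r r k; move: iE lt_mod gt_k.
by move: (i %/ t * t) (i %% t) (tnth r k : nat) (tnth r _ : nat) => x y z w; lia.
Qed.

(** * Dimension, multiplicity and conclusion *)

Lemma card_full_set n t a s (b : {ffun 'I_n -> 'I_s.+1}) :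
  0 < t -> a * t <= n -> std_mon t s (ffmon b) -> #|full_set b| <= n - a.
Proof.
move=> t_gt0 le_n /std_mon_hitting/(hitting_card t_gt0 le_n).
by have := cardsC (full_set b); rewrite card_ord; lia.
Qed.

(** Cells are grouped by the complement [C] of their full set, a minimum hitting set; the number of
    cells over [C] depends only on its size [a], hence the product. *)
Lemma card_top_cells n t a b s : 0 < a -> b < t -> n = a * t + b ->
  #|[set f : {ffun 'I_n -> 'I_s.+2} |
      std_mon t s.+1 (ffmon f) && (#|full_set f| == n - a)]|
  = 'C(a + s, a) * 'C(a + t - b - 1, a).
Proof.
move=> a_gt0 lt_bt nE; have t_gt0 : 0 < t by lia.
have le_n : a * t <= n by lia.
have le_an : a <= n by have := leq_mul (leqnn a) t_gt0; lia.
have cardC (f : {ffun 'I_n -> 'I_s.+2}) : (#|full_set f| == n - a) = (#|~: full_set f| == a).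
  by have := cardsC (full_set f); rewrite card_ord; lia.
rewrite -(card_minimum_hitting a_gt0 lt_bt nE) -[LHS]sum1_card.
rewrite (partition_big (fun f => ~: full_set f)
  (fun C => hitting t C && (#|C| == a))) /=; last first.
  by move=> f; rewrite inE cardC => /andP[/std_mon_hitting -> ->].
rewrite -sum1_card big_distrr /=.
rewrite [RHS](eq_bigl (fun C => hitting t C && (#|C| == a))); last first.
  by move=> C; rewrite inE.
apply: eq_bigr => C /andP[hC /eqP aC]; rewrite muln1.
have [c0 c0C] : exists c0, c0 \in C by apply/set0Pn; rewrite -card_gt0 aC.
have := card_capped_functions s c0C; rewrite aC => <-; rewrite -sum1_card; apply: eq_bigl => f.
rewrite !inE cardC; have -> : (full_set f == ~: C) = (~: full_set f == C).
  by rewrite -(inj_eq (@setC_inj _)) setCK.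
have [fC|] := eqVneq (~: full_set f) C; last by rewrite andbF.
rewrite fC aC eqxx !andbT; apply: (std_mon_minimum t_gt0 le_n hC aC).
by rewrite -fC setCK.
Qed.

Theorem theorem3p9 (K : fieldType) (n t a b s : nat) :
  (1 <= t)%N -> (t <= n)%N -> n = (a * t + b)%N -> (1 <= a)%N -> (b < t)%N ->
  (1 <= s)%N ->
  is_mult (pow_gens (path_gens K n t) s)
    (('C(s + a - 1, s - 1) * 'C(a + t - b - 1, a))%N)%:Z.
Proof.
move=> t_gt0 _ nE a_gt0 lt_bt; case: s => // s _.
have le_n : a * t <= n by lia.
pose good : pred 'X_{1..n} := std_mon t s.+1.
have full_le (f : {ffun 'I_n -> 'I_s.+2}) : good (ffmon f) -> #|full_set f| <= n - a.
  exact: card_full_set.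
have eE : 'C(s.+1 + a - 1, s.+1 - 1) * 'C(a + t - b - 1, a)
    = #|[set f : {ffun 'I_n -> 'I_s.+2} | good (ffmon f) && (#|full_set f| == n - a)]|.
  rewrite (card_top_cells _ a_gt0 lt_bt nE) -bin_sub; last by lia.
  by congr ('C(_, _) * _); lia.
have Q1 := hilb_num1 full_le.
exists (fun d => size (mons good d d)), (n - a), (hilb_num good s.+1 (n - a)).
split.
- move=> d; rewrite path_gensE pow_gensE; apply: hilb_fun_at_monomials.
    exact: uniq_mons.
  by move=> m; rewrite mem_mons.
- by apply: hilb_numE => // m; apply: std_mon_trunc.
(* Both binomial coefficients are positive, the second because [b < t]; this confirms [n - a] as the
   order of the pole. *)
- by rewrite Q1 -eE Num.Theory.pnatr_eq0 -lt0n muln_gt0 !bin_gt0; lia.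
- by rewrite Q1 -eE natz.
Qed.
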